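(* Let $p$ be a prime, $q$ a power of $p$, and let $f_{\mathbf a}(T)=\sum_{i\ge0}a_iT^{-i}\in\mathbb{F}_q[[T^{-1}]]$ be algebraic and irrational over $\mathbb{F}_q(T)$. Write $\mathbf a=(a_i)_{i\ge0}=\varphi(\sigma^\infty(a))$, where for some $m\ge1$, $\sigma:\mathcal A_m\to\mathcal A_m^*$ is a $p$-uniform morphism prolongable on the letter $a\in\mathcal A_m$ and $\varphi:\mathcal A_m\to\mathbb{F}_q$ is a coding. Let $e$ be the number of states of the minimal $p$-automaton (direct reading) generating $\mathbf a$ and $s$ the cardinality of the $p$-kernel of $\mathbf a$. Write the prefix of $\sigma^\infty(a)$ of length $e+1$ in the form $U'bV'b$ with $b\in\mathcal A_m$ and $U',V'$ (possibly empty) words over $\mathcal A_m$, and set $U=U'$, $V=bV'$, $k=|U|$, $\ell=|V|$, $\omega=1+1/\ell$. Then $$\frac{k+\omega\ell}{k+\ell}\le\mu(f_{\mathbf a})\le\frac{p^{s+1}(k+\ell)}{(\omega-1)\ell}.$$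
   Context: $\mathcal A_m=\{0,1,\dots,m-1\}$. A morphism $\sigma:\mathcal A_m^*\to\mathcal A_m^*$ is $p$-uniform if $|\sigma(c)|=p$ for all letters $c$; it is prolongable on $a$ if $\sigma(a)=aX$ with $X$ nonempty and $\sigma^n(X)$ nonempty for all $n$, in which case $\sigma^\infty(a)=\lim_n\sigma^n(a)$ is an infinite word; a coding is a letter-to-letter map applied letterwise. (By Christol's and Cobham's theorems such $\sigma,\varphi,a$ exist, and $e\ge m$, so the decomposition $U'bV'b$ exists.) The $p$-kernel of $(a_i)$ is the set of subsequences $(a_{p^ni+l})_{i\ge0}$, $n\ge0$, $0\le l<p^n$. Absolute value: fixed $|T|>1$, $|P/Q|=|T|^{\deg P-\deg Q}$ extended to $\mathbb{F}_q((T^{-1}))$ by $|f|=|T|^{-i_0}$, $T^{-i_0}$ the leading term. $\mu(f)$ is the supremum of real $\tau$ such that $|f-P/Q|<|Q|^{-\tau}$ has infinitely many solutions $(P,Q)\in\mathbb{F}_q[T]^2$, $Q\ne0$. *)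

(* Defs.v *)
From HB Require Import structures.
From mathcomp Require Import all_boot all_order all_algebra.
From mathcomp Require Import boolp classical_sets cardinality reals ereal exp.

Set Implicit Arguments.
Unset Strict Implicit.
Unset Printing Implicit Defensive.

Import Order.TTheory GRing.Theory Num.Theory.
Local Open Scope ring_scope.
Local Open Scope classical_set_scope.

(* ---------- Laurent series in T^{-1} over F, as coefficient maps int -> F
   (the coefficient at index j is the coefficient of T^j) ---------- *)

Section Laurent.
Variable F : finFieldType.

Definition lser_of (a : nat -> F) : int -> F :=
  fun j => match j with Posz 0 => a 0%N | Posz _ => 0 | Negz n => a n.+1 end.

Definition lser_of_poly (P : {poly F}) : int -> F :=
  fun j => match j with Posz k => P`_k | Negz _ => 0 end.

Definition polymul_ser (Q : {poly F}) (g : int -> F) : int -> F :=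
  fun j => \sum_(k < size Q) Q`_k * g (j - (k%:Z))%R.

Definition ser_bounded_above (g : int -> F) :=
  exists N : int, forall j : int, N < j -> g j = 0.

Definition is_expansion (P Q : {poly F}) (g : int -> F) :=
  ser_bounded_above g /\ polymul_ser Q g = lser_of_poly P.

Definition ps_mul (a c : nat -> F) : nat -> F :=
  fun n => \sum_(i < n.+1) a i * c (n - i)%N.
Definition ps_exp (a : nat -> F) (j : nat) : nat -> F :=
  iter j (ps_mul a) (fun n => (n == 0%N)%:R).

Definition algebraic_ser (a : nat -> F) :=
  exists Pol : {poly {poly F}}, Pol != 0 /\
    forall j : int,
      \sum_(i < size Pol) polymul_ser Pol`_i (lser_of (ps_exp a i)) j = 0.

Definition rational_ser (a : nat -> F) :=
  exists P Q : {poly F}, Q != 0 /\ is_expansion P Q (lser_of a).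

(* absolute value |g| = b^(exponent of the leading term), |0| = 0 *)
Definition labs (R : realType) (b : R) (g : int -> F) : R :=
  sup ((fun j : int => b ^ j) @` [set j | g j != 0]).

Definition approx_sols (R : realType) (b : R) (a : nat -> F) (tau : R)
  : set ({poly F} * {poly F}) :=
  [set PQ | PQ.2 != 0 /\ exists g, is_expansion PQ.1 PQ.2 g /\
      labs b (fun j => lser_of a j - g j) < (labs b (lser_of_poly PQ.2)) `^ (- tau)].

Definition mu (R : realType) (b : R) (a : nat -> F) : \bar R :=
  ereal_sup [set tau%:E | tau in [set tau : R | infinite_set (approx_sols b a tau)]].

End Laurent.

Record dfao (p : nat) (O : Type) := DFAO {
  dfao_state : finType;
  dfao_init : dfao_state;
  dfao_delta : dfao_state -> 'I_p -> dfao_state;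
  dfao_out : dfao_state -> O }.

Fixpoint rev_digits_aux (p fuel n : nat) : seq nat :=
  match fuel with
  | 0 => [::]
  | fuel'.+1 => if n == 0%N then [::] else (n %% p)%N :: rev_digits_aux p fuel' (n %/ p)%N
  end.

(* canonical base-p expansion of n, most significant digit first,
   no leading zeros (empty word for n = 0) *)
Definition base_digits (p n : nat) : seq nat := rev (rev_digits_aux p n n).

Definition dfao_run (p : nat) (O : Type) (A : dfao p O) (ds : seq nat) :=
  foldl (fun q d => match (insub d : option 'I_p) with
                    | Some d' => dfao_delta q d'
                    | None => q end) (dfao_init A) ds.

Definition dfao_generates (p : nat) (O : Type) (A : dfao p O) (a : nat -> O) :=
  forall n, a n = dfao_out (dfao_run A (base_digits p n)).

Definition min_dfao_states (p : nat) (O : Type) (a : nat -> O) (e : nat) :=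
  (exists A : dfao p O, dfao_generates A a /\ #|dfao_state A| = e) /\
  (forall A : dfao p O, dfao_generates A a -> (e <= #|dfao_state A|)%N).

Definition p_kernel (p : nat) (O : Type) (a : nat -> O) : set (nat -> O) :=
  [set g | exists n l : nat, (l < p ^ n)%N /\ g = (fun i => a (p ^ n * i + l)%N)].

Definition kernel_card (p : nat) (O : Type) (a : nat -> O) (s : nat) :=
  exists g : 'I_s -> (nat -> O), injective g /\
    forall x, p_kernel p a x <-> exists i, x = g i.

Definition morph_word (m : nat) (sigma : 'I_m -> seq 'I_m) (w : seq 'I_m) :=
  flatten (map sigma w).

Definition uniform_morph (m p : nat) (sigma : 'I_m -> seq 'I_m) :=
  forall c, size (sigma c) = p.

Definition prolongable (m : nat) (sigma : 'I_m -> seq 'I_m) (c : 'I_m) :=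
  exists X, sigma c = c :: X /\ X != [::] /\
    forall n, iter n (morph_word sigma) X != [::].

Definition is_fixpoint_limit (m : nat) (sigma : 'I_m -> seq 'I_m) (c : 'I_m)
  (w : nat -> 'I_m) :=
  forall n i, (i < size (iter n (morph_word sigma) [:: c]))%N ->
    w i = nth c (iter n (morph_word sigma) [:: c]) i.

(* Main.v *)
(* Let zeta be the identity below k and fold each i >= k into the
   block [k, k + l) modulo l (fold_index below).  Since w_k = w_(k+l),
   f agrees to order (k + l + 1) p^n with the rational series g_n obtained by
   repeating phi(sigma^n(V)) forever after phi(sigma^n(U)), whose denominator has degree
   (k + l) p^n; this gives the lower bound.  Conversely, if deg Q lies between
   p^(n-1) and p^n and P/Q approximates f with an exponent larger than
   p^(s+1) (k + l), then P/Q must coincide with each of g_n, ..., g_(n+s-1).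
   Now g_n = g_(n+1) means x(zeta i) = x(p zeta(i / p) + i mod p) for all i and
   all x in the set K_n of kernel elements (a_(p^n i + r))_i.  As K_(n+1) is
   determined by K_n and K_n has at least two elements for large n, the union
   of K_n, ..., K_(n+s-2) is already stable, so that g_j = g_n for all j >= n, and in
   the limit f = g_n is rational. *)
Require Import Defs.
From HB Require Import structures.
From mathcomp Require Import all_boot all_order all_algebra.
From mathcomp Require Import boolp classical_sets cardinality reals ereal exp.
From mathcomp Require Import zify ring.
Import Order.TTheory GRing.Theory Num.Theory.
Local Open Scope ring_scope.

Set Implicit Arguments.
Unset Strict Implicit.
Unset Printing Implicit Defensive.

(** * Fixed points of uniform morphisms; stabilisation of a chain of finite sets *)

Lemma uniform_fixpoint_eq (m p : nat) (sigma : 'I_m -> seq 'I_m) (c : 'I_m)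
  (w : nat -> 'I_m) (n i i' r : nat) :
  (1 < p)%N -> uniform_morph p sigma -> is_fixpoint_limit sigma c w ->
  w i = w i' -> (r < p ^ n)%N -> w (p ^ n * i + r)%N = w (p ^ n * i' + r)%N.
Proof.
move=> p1 hu hw hi.
have p0 : (0 < p)%N by exact: ltnW.
have size_m u : size (morph_word sigma u) = (p * size u)%N.
  by elim: u => [|x u IH]; rewrite /morph_word /= ?muln0 // size_cat IH hu mulnS.
have size_it N : size (iter N (morph_word sigma) [:: c]) = (p ^ N)%N.
  by elim: N => // N IH; rewrite iterS size_m IH expnS.
have nth_m u j t : (j < size u)%N -> (t < p)%N ->
    nth c (morph_word sigma u) (p * j + t) = nth c (sigma (nth c u j)) t.
  move=> + ht; elim: u j => // x u IH [|j] hj /=.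
    by rewrite /morph_word /= nth_cat hu muln0 add0n ht.
  rewrite /morph_word /= nth_cat hu mulnS -addnA ltnNge leq_addr /=.
  by rewrite addKn; apply: IH.
have step j t : (t < p)%N -> w (p * j + t)%N = nth c (sigma (w j)) t.
  (* Since j < p^j, index j lies in the j-th iterate and p j + t in the next one. *)
  move=> ht; have hj : (j < p ^ j)%N by exact: ltn_expl.
  rewrite (hw j.+1) ?size_it /=; last first.
    rewrite expnS; apply: (@leq_trans (p * j.+1)); last by rewrite leq_mul.
    by rewrite mulnS addnC ltn_add2r.
  by rewrite nth_m ?size_it // -(hw j) ?size_it.
(* The letters at p^n i + r with r < p^n spell sigma^n(w_i); the induction splits off the last
   base-p digit of r. *)
elim: n r => [|n IH] r; first by rewrite expn0 ltnS leqn0 !mul1n => /eqP ->; rewrite !addn0.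
move=> hr; have hr' : (r %/ p < p ^ n)%N by rewrite ltn_divLR // -expnSr.
have E j : (p ^ n.+1 * j + r = p * (p ^ n * j + r %/ p) + r %% p)%N.
  by rewrite expnS {1}(divn_eq r p); ring.
by rewrite !E !step ?ltn_mod // IH.
Qed.

(** The unions [C t] of the first t sets grow strictly until they stop for good. As [C 1] already
    has two elements, this happens at some index at most |T| - 1. *)
Lemma reachable_set_stable (T : finType) (X : nat -> {set T}) (N : T -> {set T}) :
  (forall t, X t.+1 = \bigcup_(x in X t) N x) -> (1 < #|X 0%N|)%N ->
  forall t, X t \subset \bigcup_(j < #|T|.-1) X j.
Proof.
move=> hX h0.
pose C t := \bigcup_(j < t) X j.
have CS t : C t.+1 = C t :|: X t by rewrite /C big_ord_recr.
have [j hj hst] : exists2 j, (j < #|T|)%N & (0 < j)%N && (C j.+1 == C j).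
  case: (pselect (exists2 j, (j < #|T|)%N & (0 < j)%N && (C j.+1 == C j))) => // hn.
  have hc t : (t < #|T|)%N -> (t.+1 < #|C t.+1|)%N.
    elim: t => [|t IH] ht; first by rewrite CS /C big_ord0 finset.set0U.
    have hp : (C t.+1 \proper C t.+2).
      rewrite finset.properEneq (CS t.+1) finset.subsetUl -CS andbT.
      by apply/eqP => e; apply: hn; exists t.+1; rewrite // -e eqxx.
    by apply: leq_ltn_trans (proper_card hp); apply: IH; apply: ltnW.
  have T0 : (0 < #|T|)%N by apply: leq_trans (ltnW h0) _; apply: max_card.
  have := hc #|T|.-1; rewrite prednK // => /(_ (leqnn _)).
  by rewrite ltnNge max_card.
case/andP: hst => j0 /eqP hst.
have Csub u v : (u <= v)%N -> C u \subset C v.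
  move=> uv; apply/finset.bigcupsP => i _.
  exact: (finset.bigcup_sup (Ordinal (leq_trans (ltn_ord i) uv))).
have hall t : X t \subset C j.
  elim: t => [|t IH]; first by apply: (finset.bigcup_sup (Ordinal j0)).
  rewrite hX; apply/finset.bigcupsP => x /(fintype.subsetP IH) /finset.bigcupP [i _ xi].
  rewrite -hst; apply: fintype.subset_trans (finset.bigcup_sup (lift ord0 i) _) => //=.
  by rewrite /= /bump /= add1n hX; apply: finset.bigcup_sup.
move=> t; apply: fintype.subset_trans (hall t) (Csub _ _ _); lia.
Qed.

(** * Ultimately periodic approximations and the kernel *)

Section PeriodicApproximations.
Variables (O : Type) (p k l : nat) (x : nat -> O).
Hypotheses (p1 : (1 < p)%N) (l0 : (0 < l)%N).

Definition fold_index (i : nat) : nat :=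
  if (i < k)%N then i else (k + (i - k) %% l)%N.

(* If x is the coding of the fixed point w of a p-uniform morphism, this is the
   coding of its n-th iterate applied to the ultimately periodic word obtained
   from w by repeating w_k ... w_(k+l-1) forever. *)
Definition per_approx (n i : nat) : O :=
  x (p ^ n * fold_index (i %/ p ^ n) + i %% p ^ n).

Definition kernel_seq (n r : nat) : nat -> O := fun i => x (p ^ n * i + r)%N.

Let pn0 n : (0 < p ^ n)%N.
Proof. by rewrite expn_gt0 ltnW. Qed.

Lemma per_approx_periodic n i : (k * p ^ n <= i)%N ->
  per_approx n (i + l * p ^ n) = per_approx n i.
Proof.
move=> h; rewrite /per_approx [(i + _)%N]addnC modnMDl divnMDl // addnC.
have hq : (k <= i %/ p ^ n)%N by rewrite leq_divRL.
rewrite /fold_index ltnNge (leq_trans hq (leq_addl _ _)) ltnNge hq /=.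
by rewrite -addnBA // modnDl addnC.
Qed.

Hypothesis x_repeats :
  forall n r, (r < p ^ n)%N -> x (p ^ n * (k + l) + r)%N = x (p ^ n * k + r)%N.

(** Folding fixes every block index below k + l. Block k + l is replaced by block k, which is equal
    to it; this gains one more block of agreement. *)
Lemma per_approx_prefix n i : (i < (k + l).+1 * p ^ n)%N -> per_approx n i = x i.
Proof.
rewrite -ltn_divLR // ltnS leq_eqVlt /per_approx => h.
rewrite [in RHS](divn_eq i (p ^ n)) [(_ * p ^ n)%N]mulnC /fold_index.
case/orP: h => [/eqP ->|h].
  by rewrite ltnNge leq_addr /= addKn modnn addn0 x_repeats // ltn_mod.
case: ltnP => // hk; rewrite modn_small ?subnKC //; lia.
Qed.

(** Position p^n i + r has block i and offset r at level n, but block i / p and offset p^n (i mod p)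
    + r at level n + 1. Both values are terms of the same [kernel_seq n r]. *)
Lemma per_approx_step n :
  per_approx n =1 per_approx n.+1 <->
  forall r i, (r < p ^ n)%N -> kernel_seq n r (fold_index i) =
    kernel_seq n r (p * fold_index (i %/ p) + i %% p)%N.
Proof.
have E i r : (r < p ^ n)%N ->
    (per_approx n (p ^ n * i + r) = kernel_seq n r (fold_index i)) *
    (per_approx n.+1 (p ^ n * i + r) =
       kernel_seq n r (p * fold_index (i %/ p) + i %% p)%N).
  move=> hr; have d : ((p ^ n * i + r) %/ p ^ n = i)%N.
    by rewrite mulnC divnMDl // divn_small // addn0.
  have m : ((p ^ n * i + r) %% p ^ n = r)%N by rewrite mulnC modnMDl modn_small.
  rewrite /per_approx /kernel_seq expnSr divnMA d m; split => //.
  congr x; rewrite mulnDr mulnA -addnA; congr addn.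
  rewrite [in LHS](divn_eq i p) mulnDr -addnA mulnCA.
  rewrite modnMDl modn_small // (@leq_trans (p ^ n * (i %% p).+1)) //.
    by rewrite mulnS addnC ltn_add2r.
  by rewrite leq_mul2l ltn_mod ltnW ?orbT.
split=> [h r i hr|h i]; first by rewrite -!E // h.
rewrite (divn_eq i (p ^ n)) mulnC !E ?ltn_mod //.
by rewrite h // ltn_mod.
Qed.

Variable s : nat.
Hypothesis hs : kernel_card p x s.

(* The equality of two consecutive approximations is a condition on the
   elements a_(p^n i + r) of the kernel, and the elements of level at least n
   all occur within s - 1 consecutive levels. *)
Lemma per_approx_stable n :
  (exists r i, (r < p ^ n)%N /\ kernel_seq n r i <> kernel_seq n 0 i) ->
  (forall h, (h < s)%N -> per_approx (n + h) =1 per_approx n) ->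
  forall t, per_approx (n + t) =1 per_approx n.
Proof.
case: hs => g [ginj gP] [r0 [i0 [r0n ne]]] heq.
(* [X t] encodes the kernel elements of level n + t, and [N y] the p subsequences of y along residue
   classes mod p, which lie one level higher. *)
pose X t := [set i | `[< exists2 r, (r < p ^ (n + t))%N & g i = kernel_seq (n + t) r >]]%SET.
pose N y := [set i | [exists j : 'I_p, `[< g i = fun t => g y (p * t + j)%N >]]]%SET.
have inX t r : (r < p ^ (n + t))%N -> exists2 y, y \in X t & g y = kernel_seq (n + t) r.
  move=> hr; have [|y hy] := (gP (kernel_seq (n + t) r)).1; first by exists (n + t)%N, r.
  by exists y; rewrite // inE; apply/asboolP; exists r.
have XP t y : y \in X t -> exists2 r, (r < p ^ (n + t))%N & g y = kernel_seq (n + t) r.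
  by rewrite inE => /asboolP.
have succ t r j : (fun i => kernel_seq t r (p * i + j)%N) = kernel_seq t.+1 (p ^ t * j + r).
  apply/funext => i; rewrite /kernel_seq; congr x; rewrite expnSr; ring.
have hX t : X t.+1 = (\bigcup_(y in X t) N y)%SET.
  apply/setP => y; apply/idP/finset.bigcupP => [/XP [r hr hy]|[z /XP [r hr hz]]].
    have [|z zX hz] := inX t (r %% p ^ (n + t))%N; first by rewrite ltn_mod.
    have hj : (r %/ p ^ (n + t) < p)%N by rewrite ltn_divLR // -expnS -addnS.
    exists z => //; rewrite inE; apply/existsP; exists (Ordinal hj); apply/asboolP.
    rewrite hz succ hy addnS /=; congr kernel_seq.
    by rewrite {1}(divn_eq r (p ^ (n + t))) mulnC.
  rewrite inE => /existsP [j /asboolP hy]; rewrite inE; apply/asboolP.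
  rewrite addnS; exists (p ^ (n + t) * j + r)%N; last by rewrite hy hz succ.
  rewrite expnSr (@leq_trans (p ^ (n + t) * j.+1)) ?leq_mul //.
  by rewrite mulnS addnC ltn_add2r.
have X0 : (1 < #|X 0%N|)%N.
  have [|y yX hy] := inX 0%N r0; first by rewrite addn0.
  have [//|z zX hz] := inX 0%N 0%N.
  apply/card_gt1P; exists y, z; split => //; apply/eqP => yz.
  by apply: ne; rewrite -(addn0 n) -hy yz hz.
have sX := reachable_set_stable hX X0.
have good t r i : (r < p ^ (n + t))%N -> kernel_seq (n + t) r (fold_index i) =
    kernel_seq (n + t) r (p * fold_index (i %/ p) + i %% p)%N.
  move=> /inX [y /(fintype.subsetP (sX t)) /finset.bigcupP [u _ /XP [r' hr' hy]] <-].
  rewrite hy; move: r' i hr' {hy}; apply/per_approx_step => i.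
  (* Here u < s - 1, so [heq] covers both levels n + u and n + u + 1. *)
  have := ltn_ord u; rewrite [X in (_ < X.-1)%N]card_ord => hu.
  by rewrite -addnS !heq //; lia.
elim=> [|t IH] i; first by rewrite addn0.
by rewrite -IH addnS; apply/esym; move: i; apply/per_approx_step => r i; apply: good.
Qed.

Lemma per_approx_stable_eventually : (exists i, x i <> x 0%N) ->
  exists n0, forall n, (n0 <= n)%N ->
  (forall h, (h < s)%N -> per_approx (n + h) =1 per_approx n) ->
  forall i, (k * p ^ n <= i)%N -> x (i + l * p ^ n)%N = x i.
Proof.
move=> [i0 hi0]; exists i0 => n hn heq.
have ne : exists r i, (r < p ^ n)%N /\ kernel_seq n r i <> kernel_seq n 0 i.
  (* For n >= i0 the offset i0 is below p^n, and offsets i0 and 0 already differ at argument 0. *)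
  exists i0, 0%N; rewrite /kernel_seq !muln0 !add0n; split => //.
  exact: leq_ltn_trans hn (ltn_expl _ p1).
have xE i : x i = per_approx n i.
  rewrite -(per_approx_stable ne heq i) per_approx_prefix // mulSn.
  apply: (@leq_trans (p ^ (n + i))); last exact: leq_addr.
  by rewrite (leq_trans (ltn_expl i p1)) // leq_exp2l // leq_addl.
by move=> i hi; rewrite !xE per_approx_periodic.
Qed.

End PeriodicApproximations.

(** * Products of polynomials and Laurent series; expansions of rational functions *)

Section Laurent.
Variable F : finFieldType.
Implicit Types (P Q : {poly F}) (u v g : int -> F).

(** Together with boundedness above, this says that the series is a polynomial. *)
Definition negfree v := forall n, v (Negz n) = 0.

Lemma polymul_ser_widen N Q g j : (size Q <= N)%N ->
  polymul_ser Q g j = \sum_(i < N) Q`_i * g (j - i%:Z).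
Proof.
move=> h; rewrite /polymul_ser (big_ord_widen _ (fun i => Q`_i * g (j - i%:Z)) h).
rewrite big_mkcond; apply: eq_bigr => i _; case: ltnP => // hi.
by rewrite nth_default // mul0r.
Qed.

Lemma polymul_serD Q1 Q2 g j :
  polymul_ser (Q1 + Q2) g j = polymul_ser Q1 g j + polymul_ser Q2 g j.
Proof.
pose N := maxn (size Q1) (size Q2).
rewrite !(@polymul_ser_widen N) ?leq_maxl ?leq_maxr ?size_polyD // -big_split.
by apply: eq_bigr => i _; rewrite coefD mulrDl.
Qed.

Lemma polymul_serN Q g j : polymul_ser (- Q) g j = - polymul_ser Q g j.
Proof.
rewrite /polymul_ser size_polyN -sumrN; apply: eq_bigr => i _.
by rewrite coefN mulNr.
Qed.

Lemma polymul_serBr Q u v j :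
  polymul_ser Q (fun i => u i - v i) j = polymul_ser Q u j - polymul_ser Q v j.
Proof. by rewrite /polymul_ser -sumrB; apply: eq_bigr => i _; rewrite mulrBr. Qed.

Lemma polymul_serMX Q g j : polymul_ser (Q * 'X) g j = polymul_ser Q g (j - 1).
Proof.
rewrite (@polymul_ser_widen (size Q).+1); last first.
  by apply: leq_trans (size_polyMleq _ _) _; rewrite size_polyX addn2.
rewrite big_ord_recl coefMX mul0r add0r; apply: eq_bigr => i _.
rewrite coefMX /=; congr (_ * g _); rewrite /bump /=; lia.
Qed.

Lemma polymul_serC c Q g j : polymul_ser (c%:P * Q) g j = c * polymul_ser Q g j.
Proof.
rewrite (@polymul_ser_widen (size Q)) ?mul_polyC ?size_scale_leq // mulr_sumr.
by apply: eq_bigr => i _; rewrite coefZ mulrA.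
Qed.

Lemma polymul_serM Q1 Q2 g j :
  polymul_ser (Q1 * Q2) g j = polymul_ser Q1 (polymul_ser Q2 g) j.
Proof.
elim/poly_ind: Q1 j => [|Q1 c IH] j; first by rewrite mul0r /polymul_ser size_poly0 !big_ord0.
rewrite mulrDl mulrAC !polymul_serD !polymul_serMX IH polymul_serC; congr (_ + _).
by rewrite (@polymul_ser_widen 1 c%:P) ?size_polyC_leq1 // big_ord1 coefC /= subr0.
Qed.

Lemma polymul_serXn n g j : polymul_ser 'X^n g j = g (j - n%:Z).
Proof.
elim: n j => [|n IH] j; last by rewrite exprSr polymul_serMX IH; congr g; lia.
by rewrite expr0 /polymul_ser size_poly1 big_ord1 coef1 mul1r.
Qed.

Lemma polymul_ser_negfree Q v : negfree v -> negfree (polymul_ser Q v).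
Proof.
move=> hv n; rewrite /polymul_ser big1 // => i _.
by rewrite (_ : Negz n - i%:Z = Negz (n + i)) ?hv ?mulr0 //; lia.
Qed.

(** With d = deg Q, the coefficient of T^-(i+1) in Q u is the leading coefficient of Q times u at
    -(d+i+1), plus terms with values of u at larger exponents. This recurrence propagates the zeros
    downwards. *)
Lemma negfree_eq0 Q u : Q != 0 -> negfree (polymul_ser Q u) ->
  (forall j : int, - (size Q).-1%:Z <= j -> u j = 0) -> forall j, u j = 0.
Proof.
move=> Q0 hf h0; set d := (size Q).-1 in h0 *.
have sQ : size Q = d.+1 by rewrite /d prednK // size_poly_gt0.
have h i j : - (d + i)%:Z <= j -> u j = 0.
  elim: i j => [|i IH] j hj; first by apply: h0; lia.
  have [/IH //|hj'] := lerP (- (d + i)%:Z) j.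
  have := hf i; rewrite /polymul_ser sQ big_ord_recr big1 /= => [|t _]; last first.
    by rewrite IH ?mulr0 //; have := ltn_ord t; lia.
  rewrite add0r (_ : _ - _ = j); last by lia.
  by move=> /eqP; rewrite mulf_eq0 -[d]/(size Q).-1 -lead_coefE lead_coef_eq0 (negbTE Q0) => /eqP.
by move=> j; apply: (h `|j|%N); lia.
Qed.

(** This is |g1 - g2| >= 1 / |Q1 Q2| for distinct rational functions: Q1 Q2 (g1 - g2) is a
    polynomial. *)
Lemma expansion_unique P1 Q1 g1 P2 Q2 g2 :
  Q1 != 0 -> Q2 != 0 -> is_expansion P1 Q1 g1 -> is_expansion P2 Q2 g2 ->
  (forall j : int, - ((size Q1).-1 + (size Q2).-1)%:Z <= j -> g1 j = g2 j) ->
  forall j, g1 j = g2 j.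
Proof.
move=> h1 h2 [_ e1] [_ e2] h j; apply/eqP; rewrite -subr_eq0; apply/eqP; move: j.
apply: (@negfree_eq0 (Q1 * Q2)); first by rewrite mulf_neq0.
- move=> n; rewrite polymul_serBr {1}mulrC !polymul_serM e1 e2.
  by rewrite !polymul_ser_negfree // subr0.
- move=> j; rewrite size_mul //.
  have -> : (size Q1 + size Q2).-2 = ((size Q1).-1 + (size Q2).-1)%N.
    move: h1 h2; rewrite -!size_poly_gt0.
    by case: (size Q1) (size Q2) => [|d1] [|d2] //; rewrite addSn addnS.
  by move=> /h ->; rewrite subrr.
Qed.

Lemma is_expansion_ex Q g : ser_bounded_above g -> negfree (polymul_ser Q g) ->
  exists P, is_expansion P Q g.
Proof.
case=> N hN hf.
exists (\poly_(i < (`|N| + size Q).+1) polymul_ser Q g i%:Z); split; first by exists N.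
apply/funext; case=> n; last exact: hf.
rewrite /= coef_poly; case: ltnP => // hn.
rewrite /polymul_ser big1 // => i _; rewrite hN ?mulr0 //.
have : (`|N| + i < n)%N by apply: leq_trans hn; rewrite ltnS leq_add2l ltnW.
lia.
Qed.

Lemma lser_of_bounded (x : nat -> F) : ser_bounded_above (lser_of x).
Proof. by exists 0 => -[[]|]. Qed.

Lemma lser_ofN (x : nat -> F) (i : nat) : lser_of x (- i%:Z) = x i.
Proof. by case: i => [|i] //; rewrite -NegzE. Qed.

(** This is X^k (X^l - 1): the second factor cancels the period, the first makes the remaining
    preperiod polynomial. *)
Definition per_denom (k l : nat) : {poly F} := 'X^(k + l) - 'X^k.

Lemma size_per_denom k l : (0 < l)%N -> size (per_denom k l) = (k + l).+1.
Proof.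
move=> l0; rewrite /per_denom size_polyDl ?size_polyXn // size_polyN size_polyXn; lia.
Qed.

Lemma per_denom_neq0 k l : (0 < l)%N -> per_denom k l != 0.
Proof. by move=> l0; rewrite -size_poly_gt0 size_per_denom. Qed.

Lemma periodic_expansion (x : nat -> F) k l :
  (forall i, (k <= i)%N -> x (i + l)%N = x i) ->
  exists P, is_expansion P (per_denom k l) (lser_of x).
Proof.
move=> h; apply: is_expansion_ex; first exact: lser_of_bounded.
move=> n; rewrite polymul_serD polymul_serN !polymul_serXn.
rewrite (_ : Negz n - (k + l)%:Z = - (n.+1 + k + l)%:Z); last by lia.
rewrite (_ : Negz n - k%:Z = - (n.+1 + k)%:Z); last by lia.
by rewrite !lser_ofN h ?subrr //; lia.
Qed.

Lemma periodic_rational (x : nat -> F) k l : (0 < l)%N ->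
  (forall i, (k <= i)%N -> x (i + l)%N = x i) -> rational_ser x.
Proof.
move=> l0 /periodic_expansion [P hP].
by exists P, (per_denom k l); rewrite per_denom_neq0.
Qed.

(** * Estimates for the absolute value *)

Section AbsoluteValue.
Variables (R : realType) (b : R).
Hypothesis b1 : 1 < b.

Lemma labs_ge g j : ser_bounded_above g -> g j != 0 -> b ^ j <= labs b g.
Proof.
move=> [N hN] hj; rewrite /labs.
apply: ub_le_sup; last by exists j.
exists (b ^ N) => _ [i /= hi <-]; rewrite ler_eXz2l //.
by rewrite leNgt; apply: contra hi => /hN ->.
Qed.

Lemma labs_le g N : (forall j : int, N < j -> g j = 0) -> labs b g <= b ^ N.
Proof.
move=> hN; rewrite /labs.
(* For g = 0 the set of powers is empty and its [sup] is 0 by convention. *)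
have [->|/set0P[y hy]] := eqVneq [set b ^ j | j in [set j | g j != 0]]%classic set0.
  by rewrite sup0 exprz_ge0 // ltW // (lt_trans _ b1).
apply: ge_sup; first by exists y.
move=> _ [i /= hi <-]; rewrite ler_eXz2l //.
by rewrite leNgt; apply: contra hi => /hN ->.
Qed.

Lemma labs_poly Q : Q != 0 -> labs b (lser_of_poly Q) = b ^+ (size Q).-1.
Proof.
move=> Q0; have h (j : int) : (size Q).-1%:Z < j -> lser_of_poly Q j = 0.
  by case: j => // n; rewrite ltz_nat /= => hn; rewrite nth_default //; case: (size Q) hn.
apply/eqP; rewrite eq_le (@labs_le _ (size Q).-1%:Z) //=.
apply: (@labs_ge _ (size Q).-1%:Z); first by exists (size Q).-1%:Z.
by rewrite /= -lead_coefE lead_coef_eq0.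
Qed.

End AbsoluteValue.
End Laurent.

(** * Lower and upper bounds for the irrationality exponent *)

Section Approximation.
Variables (F : finFieldType) (R : realType) (b : R).
Hypothesis b1 : 1 < b.
Implicit Types (P Q : {poly F}) (x : nat -> F) (tau : R).

Let b0 : 0 < b. Proof. exact: lt_trans b1. Qed.

Lemma labs_poly_powR Q tau : Q != 0 ->
  labs b (lser_of_poly Q) `^ (- tau) = b `^ (- (tau * (size Q).-1%:R)).
Proof.
by move=> Q0; rewrite labs_poly // -(powR_mulrn _ (ltW b0)) -powRrM mulrN mulrC.
Qed.

(** A nonzero difference at exponent j would give |f - g| >= b^j >= |Q|^(-tau). *)
Lemma approx_agree x tau Q (g : int -> F) (j : int) :
  Q != 0 -> ser_bounded_above g ->
  labs b (fun j => lser_of x j - g j) < labs b (lser_of_poly Q) `^ (- tau) ->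
  - (tau * (size Q).-1%:R) <= j%:~R -> g j = lser_of x j.
Proof.
move=> Q0 [N hN]; rewrite labs_poly_powR // => hlt hj.
apply/esym/eqP; rewrite -subr_eq0; apply/negPn/negP => ne.
have [M hM] := lser_of_bounded x.
have bd : ser_bounded_above (fun j => lser_of x j - g j).
  by exists (Num.max N M) => i; rewrite gt_max => /andP[/hN -> /hM ->]; rewrite subrr.
have := le_lt_trans (labs_ge b1 bd ne) hlt.
by apply/negP; rewrite -leNgt -(powR_intmul _ (ltW b0)) ler_powR // ltW.
Qed.

Lemma agree_approx x tau Q (g : int -> F) (N : nat) : Q != 0 ->
  (forall i, (i < N)%N -> g (- i%:Z) = x i) ->
  (forall j : int, 0 < j -> g j = 0) ->
  tau * (size Q).-1%:R < N%:R ->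
  labs b (fun j => lser_of x j - g j) < labs b (lser_of_poly Q) `^ (- tau).
Proof.
move=> Q0 hx h0 hN; rewrite labs_poly_powR //.
apply: (@le_lt_trans _ _ (b ^ (- N%:Z))).
  apply: labs_le => // j hj; have [jp|jn] := ltrP 0 j.
    by rewrite h0 // subr0; case: j jp {hj} => [[]|].
  by rewrite (_ : j = - `|j|%N%:Z) ?hx ?lser_ofN ?subrr //; lia.
rewrite -(powR_intmul _ (ltW b0)) /powR gt_eqF // ltr_expR ltr_pM2r ?ln_gt0 //.
by rewrite mulrNz ltrN2.
Qed.

Lemma finite_size_poly N : finite_set [set P : {poly F} | (size P <= N)%N]%classic.
Proof.
apply: (@sub_finite_set _ _ (@rVpoly F N @` setT)%classic).
  by move=> P /= hP; exists (poly_rV P) => //; rewrite poly_rV_K.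
exact/finite_image/finite_finset.
Qed.

Variables (p k l : nat) (x : nat -> F).
Hypotheses (p1 : (1 < p)%N) (l0 : (0 < l)%N).
Hypothesis x_repeats :
  forall n r, (r < p ^ n)%N -> x (p ^ n * (k + l) + r)%N = x (p ^ n * k + r)%N.

Let pn0 n : (0 < p ^ n)%N.
Proof. by rewrite expn_gt0 ltnW. Qed.

Let ln0 n : (0 < l * p ^ n)%N.
Proof. by rewrite muln_gt0 l0 pn0. Qed.

Lemma per_approx_expansion n : exists P,
  is_expansion P (per_denom F (k * p ^ n) (l * p ^ n)) (lser_of (per_approx p k l x n)).
Proof. by apply: periodic_expansion => i; apply: per_approx_periodic. Qed.

Lemma mu_ge : (((k + l).+1%:R / (k + l)%:R : R)%:E <= mu b x)%E.
Proof.
have kl0 : 0 < (k + l)%:R :> R by rewrite ltr0n addn_gt0 l0 orbT.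
apply/lee_subgt0Pr => e e0; apply: ereal_sup_ubound; exists ((k + l).+1%:R / (k + l)%:R - e) => //=.
set tau := _ - e.
have [P hP] := choice per_approx_expansion.
move=> /(finite_image (fun PQ : {poly F} * {poly F} => size PQ.2)) fin; apply: infinite_nat.
(* [f n] is the size of the n-th denominator; its injectivity yields infinitely many solutions. *)
pose f n := ((k + l) * p ^ n).+1.
have finj : injective f.
  move=> u v [] /eqP; rewrite eqn_pmul2l ?addn_gt0 ?l0 ?orbT //.
  by rewrite eqn_exp2l // => /eqP.
have ffin : finite_set (f @` setT)%classic.
  apply: sub_finite_set fin => _ [n _ <-].
  exists (P n, per_denom F (k * p ^ n) (l * p ^ n)); last first.
    by rewrite /= size_per_denom // -mulnDl.
  split; first exact: per_denom_neq0.
  exists (lser_of (per_approx p k l x n)); split; first exact: hP.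
  apply: (@agree_approx _ _ _ _ ((k + l).+1 * p ^ n)); first exact: per_denom_neq0.
  - by move=> i hi; rewrite lser_ofN per_approx_prefix.
  - by case=> [[]|].
  - rewrite size_per_denom // -mulnDl /= !natrM mulrA ltr_pM2r ?ltr0n //.
    by rewrite -ltr_pdivlMr // /tau ltrBlDr ltrDl.
apply: sub_finite_set (finite_preimage _ ffin); first by move=> n _; exists n.
by move=> u v _ _ /finj.
Qed.

Variable s : nat.
Hypothesis hs : kernel_card p x s.
Hypothesis irrational : ~ rational_ser x.

Lemma mu_le : (mu b x <= ((p ^ s.+1 * (k + l))%:R : R)%:E)%E.
Proof.
(* From some level on, s consecutive approximations cannot all coincide, or x would be ultimately
   periodic. *)
have [n0 hn0] : exists n0, forall n, (n0 <= n)%N -> ~ (forall h, (h < s)%N ->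
    per_approx p k l x (n + h) =1 per_approx p k l x n).
  have hx : exists i, x i <> x 0%N.
    apply: contrapT => hc; apply: irrational; apply: (@periodic_rational _ _ 0 1) => // i _.
    have E j : x j = x 0%N by apply: contrapT => hj; apply: hc; exists j.
    by rewrite (E i) E.
  have [n0 hn0] := per_approx_stable_eventually p1 l0 x_repeats hs hx.
  exists n0 => n hn h; apply: irrational.
  exact: periodic_rational (ln0 n) (hn0 n hn h).
apply: ge_ereal_sup => _ [tau /= hinf <-]; rewrite lee_fin leNgt; apply/negP => htau.
apply: hinf.
have tau0 : 0 <= tau by apply: le_trans (ltW htau); rewrite ler0n.
(* Finiteness follows by bounding the sizes of P and Q by p^n0. *)
apply: (@sub_finite_set _ _ ([set P : {poly F} | (size P <= p ^ n0)%N] `*`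
  [set Q : {poly F} | (size Q <= p ^ n0)%N])%classic); last first.
  exact: finite_setX (finite_size_poly _) (finite_size_poly _).
case=> P Q [/= Q0 [g [[gbd eg] hg]]].
have agree j := @approx_agree x tau Q g j Q0 gbd hg.
(* As tau >= 0, g agrees with f at all exponents j >= 0; hence deg P <= deg Q. *)
have g_pos (j : int) : 0 < j -> g j = 0.
  move=> j0; rewrite agree; first by case: j j0 => [[]|].
  apply: (@le_trans _ _ 0); last by rewrite ler0z ltW.
  by rewrite oppr_le0 mulr_ge0.
have sP : (size P <= size Q)%N.
  apply/leq_sizeP => j hj; have := congr1 (fun v => v j%:Z) eg; rewrite /= => <-.
  rewrite /polymul_ser big1 // => i _; rewrite g_pos ?mulr0 //.
  by have := leq_trans (ltn_ord i) hj; lia.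
suff sQ : (size Q <= p ^ n0)%N by split => //=; apply: leq_trans sQ.
rewrite leqNgt; apply/negP => big.
set d := (size Q).-1.
have dn0 : (p ^ n0 <= d)%N by rewrite /d; case: (size Q) big.
have d0 : (0 < d)%N by exact: leq_trans dn0.
(* This n satisfies p^(n-1) <= d < p^n. *)
pose n := (trunc_log p d).+1.
have nd : (p ^ n.-1 <= d)%N by apply: trunc_logP.
have dn : (d < p ^ n)%N by apply: trunc_log_ltn.
have n0n : (n0 <= n)%N by rewrite -(leq_exp2l _ _ p1) (leq_trans dn0) // ltnW.
apply: (hn0 n n0n).
have key h : (h < s)%N -> forall j, g j = lser_of (per_approx p k l x (n + h)) j.
  move=> hs'; have [P' hP'] := per_approx_expansion (n + h).
  apply: (expansion_unique Q0 (per_denom_neq0 _ _ (ln0 _)) (conj gbd eg) hP') => j.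
  rewrite size_per_denom // -mulnDl -[(size Q).-1]/d /= => hj.
  have [jp|jn] := ltrP 0 j; first by rewrite g_pos //; case: j jp {hj} => [[]|].
  have pnh : (p ^ n <= p ^ (n + h))%N by rewrite leq_exp2l // leq_addr.
  rewrite agree.
    (* From d < p^n, the range d + (k + l) p^(n+h) stays within the (k + l + 1) p^(n+h) coefficients
       shared with x. *)
    rewrite (_ : j = - `|j|%N%:Z); last by lia.
    rewrite !lser_ofN per_approx_prefix // mulSn.
    apply: (@leq_ltn_trans (d + (k + l) * p ^ (n + h))%N); first by lia.
    by rewrite ltn_add2r (leq_trans dn).
  apply: (@le_trans _ _ (- (p ^ s.+1 * (k + l) * d)%:R)).
    by rewrite lerN2 natrM ler_wpM2r // ltW.
  rewrite pmulrn -mulrNz ler_int; apply: le_trans hj; rewrite lerN2 lez_nat.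
  (* It remains to see d + (k + l) p^(n+h) <= p^(s+1) (k + l) d. Each summand is at most (k + l) p^s
     d, the second because h < s, and the extra factor p >= 2 absorbs both. *)
  have b1' : (p ^ (n + h) <= p ^ s * d)%N.
    apply: (@leq_trans (p ^ (s + n.-1))); last by rewrite expnD leq_mul2l nd orbT.
    by rewrite leq_exp2l //=; lia.
  have c1 : (1 <= (k + l) * p ^ s)%N by rewrite muln_gt0 addn_gt0 l0 orbT pn0.
  apply: (@leq_trans ((k + l) * p ^ s * d + (k + l) * p ^ s * d)).
    by rewrite leq_add // ?leq_pmull // -mulnA leq_mul2l b1' orbT.
  rewrite addnn -mul2n expnS -!mulnA [((p ^ s) * ((k + l) * _))%N]mulnCA.
  by rewrite leq_mul2r p1 orbT.
move=> h hs' i; have s0 : (0 < s)%N by exact: leq_ltn_trans hs'.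
by have := key h hs' (- i%:Z); rewrite (key 0%N s0) !lser_ofN addn0 => ->.
Qed.

End Approximation.

(** * Application to the repeated letter b *)

Theorem theorem3p7 (R : realType) (absT : R) (p : nat) (F : finFieldType)
  (m : nat) (sigma : 'I_m -> seq 'I_m) (a0 : 'I_m) (phi : 'I_m -> F)
  (w : nat -> 'I_m) (a : nat -> F) (e s : nat) (U' V' : seq 'I_m) (b : 'I_m) :
  1 < absT ->
  prime p -> p \in [pchar F] ->
  (0 < m)%N ->
  uniform_morph p sigma -> prolongable sigma a0 ->
  is_fixpoint_limit sigma a0 w ->
  (forall i, a i = phi (w i)) ->
  algebraic_ser a -> ~ rational_ser a ->
  min_dfao_states p a e -> kernel_card p a s ->
  [seq w i | i <- iota 0 e.+1] = U' ++ b :: V' ++ [:: b] ->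
  let U := U' in let V := b :: V' in
  let k := size U in let l := size V in
  let omega : R := 1 + l%:R^-1 in
  (((k%:R + omega * l%:R) / (k + l)%:R)%:E <= mu absT a)%E /\
  (mu absT a <= ((p ^ s.+1)%:R * (k + l)%:R / ((omega - 1) * l%:R))%:E)%E.
Proof.
move=> T1 p_prime _ _ hu _ hw ha _ irr _ hs prefix U V k l omega.
have p1 := prime_gt1 p_prime.
have l0 : (0 < l)%N by [].
have lR : l%:R != 0 :> R by rewrite pnatr_eq0 -lt0n.
have he : e = (k + l)%N.
  move/(congr1 size): prefix; rewrite size_map size_iota !size_cat /= size_cat /=.
  by rewrite /k /l /U /V /=; lia.
have wE i : (i < e.+1)%N -> w i = nth b (U' ++ b :: V' ++ [:: b]) i.
  by move=> hi; rewrite -prefix (nth_map 0%N) ?size_iota // nth_iota.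
have wk : w k = b by rewrite wE ?he ?ltnS ?leq_addr // nth_cat ltnn subnn.
have wkl : w (k + l)%N = b.
  rewrite wE ?he // nth_cat ltnNge leq_addr /= addKn /l /V /=.
  by rewrite nth_cat ltnn subnn.
have rep n r : (r < p ^ n)%N -> a (p ^ n * (k + l) + r)%N = a (p ^ n * k + r)%N.
  move=> hr; rewrite !ha; congr phi.
  by apply: (uniform_fixpoint_eq p1 hu hw) => //; rewrite wk wkl.
(* With omega = 1 + 1/l the bounds become (k + l + 1) / (k + l) and p^(s+1) (k + l). *)
have omegal : omega * l%:R = l%:R + 1 by rewrite mulrDl mul1r mulVf.
have omegal1 : (omega - 1) * l%:R = 1 by rewrite /omega [1 + _]addrC addrK mulVf.
split.
  by rewrite omegal addrA -natrD -[1]/(1%:R) -natrD addn1; apply: mu_ge rep.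
by rewrite omegal1 divr1 -natrM; apply: mu_le rep _ hs irr.
Qed.
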